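(* Let $X$ be a Cayley graph of a finitely presented group. Then there exists $R$ such that every Cayley graph (of any finitely generated group) which is $R$-locally $X$ is covered by $X$.
   Context: A ''graph'' means a connected, locally finite graph without loops or multiple edges, equipped with the geodesic metric giving each edge length $1$; ''$x\in X$'' means that $x$ is a vertex of $X$; balls are closed balls. A covering from a graph $X$ to a graph $Y$ is a graph covering map (a surjective graph morphism which, for every vertex $x$, maps the neighbors of $x$ bijectively onto the neighbors of its image); $Y$ is covered by $X$ if such a map $X\to Y$ exists. Given a finitely generated group $G$ and a finite symmetric generating set $S$, the Cayley graph $(G,S)$ is the graph with vertex set $G$ and distance $d(g,h)=|g^{-1}h|_S$ (word length). Given a graph $X$ and $R>0$, a graph $Y$ is $R$-locally $X$ if for every vertex $y\in Y$ there exists $x\in X$ such that the balls $B_X(x,R)$ and $B_Y(y,R)$, equipped with their intrinsic geodesic metrics, are isometric. *)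

(* Defs.v *)
From HB Require Import structures.
From mathcomp Require Import all_boot all_order all_algebra.
From mathcomp Require Import reals.

Set Implicit Arguments.
Unset Strict Implicit.
Unset Printing Implicit Defensive.

(* Simple undirected graphs, connected and locally finite; the vertex set may
   be infinite. A walk from [x] to [y] of length [size p] is a sequence [p]
   with [path adj x p] and [last x p = y]. *)
Record graph := Graph {
  vertex :> eqType;
  adj : rel vertex;
  adj_sym : symmetric adj;
  adj_irr : irreflexive adj;
  adj_connected : forall x y, exists2 p, path adj x p & last x p = y;
  adj_locally_finite : forall x, exists s : seq vertex, {subset adj x <= s}
}.

Arguments adj {g}.

Section Metric.
Variable X : graph.
Implicit Types (A : X -> Prop) (x y : X) (n : nat).

Definition walk_in A x y n : Prop :=
  exists p : seq X, [/\ path adj x p, last x p = y, size p = n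
                      & forall z, z \in x :: p -> A z].

(* [dist_in A x y n]: the geodesic distance from [x] to [y] in the subgraph
   induced on [A] is [n]. It is a relation because the distance is undefined
   (infinite) between distinct components of [A]. *)
Definition dist_in A x y n : Prop :=
  walk_in A x y n /\ forall m, walk_in A x y m -> n <= m.

Definition dist : X -> X -> nat -> Prop := dist_in (fun=> True).

Definition ball (K : realType) x (r : K) : X -> Prop :=
  fun z => exists2 n, dist x z n & (n%:R <= r)%R.

End Metric.

(* The balls of radius [r] carry the geodesic metric of the subgraph they
   induce, not the restriction of the metric of the ambient graph. The isometry
   is not required to send the centre to the centre. Only the values of [f] on
   the first ball matter; injectivity follows from the preservation of
   distance 0. *)
Definition isometric_balls (K : realType) (r : K)
    (X : graph) (x : X) (Y : graph) (y : Y) : Prop :=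
  exists f : X -> Y,
    [/\ forall u, ball x r u -> ball y r (f u),
        forall v, ball y r v -> exists2 u, ball x r u & f u = v
      & forall u v, ball x r u -> ball x r v -> forall n,
          dist_in (ball x r) u v n <-> dist_in (ball y r) (f u) (f v) n].

(* [locally r X Y]: [Y] is [r]-locally [X]. *)
Definition locally (K : realType) (r : K) (X Y : graph) : Prop :=
  forall y : Y, exists x : X, isometric_balls r x y.

Definition covering (X Y : graph) (f : X -> Y) : Prop :=
  [/\ forall y, exists x, f x = y,
      forall x x', adj x x' -> adj (f x) (f x'),
      forall x, {in adj x &, injective f}
    & forall x y, adj (f x) y -> exists2 x', adj x x' & f x' = y].

Definition covered_by (Y X : graph) : Prop := exists f : X -> Y, covering f.

Local Open Scope group_scope.

Record generating_set (G : groupType) := GeneratingSet {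
  gens :> seq G;
  gens_sym : forall s, s \in gens -> s^-1 \in gens;
  gens_gen : forall g : G, exists2 w : seq G,
    {subset w <= gens} & \prod_(s <- w) s = g
}.

Definition word_length (G : groupType) (S : generating_set G) (g : G) n :=
  (exists w : seq G,
    [/\ {subset w <= gens S}, \prod_(s <- w) s = g & size w = n]) /\
  forall w : seq G,
    {subset w <= gens S} -> \prod_(s <- w) s = g -> (n <= size w)%N.

Section Cayley.
Variables (G : groupType) (S : generating_set G).

(* Adjacency is being at word distance 1; [S] may contain the identity, which
   contributes no loop. *)
Definition cayley_adj : rel G := fun g h => (g != h) && (g^-1 * h \in gens S).

Lemma cayley_sym : symmetric cayley_adj.
Proof.
have half g h : cayley_adj g h -> cayley_adj h g.
  move=> /andP[ne /gens_sym]; rewrite invgM invgK => hS.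
  by rewrite /cayley_adj eq_sym ne.
by move=> g h; apply/idP/idP; apply: half.
Qed.

Lemma cayley_irr : irreflexive cayley_adj.
Proof. by move=> g; rewrite /cayley_adj eqxx. Qed.

Lemma cayley_walk (w : seq G) (g : G) : {subset w <= gens S} ->
  exists p, [/\ path cayley_adj g p, last g p = g * \prod_(s <- w) s
              & (size p <= size w)%N].
Proof.
elim: w g => [|s w IH] g wS; first by exists [::]; rewrite big_nil mulg1.
have {}/IH IH : {subset w <= gens S}.
  by move=> x xw; apply: wS; rewrite inE xw orbT.
have sS : s \in gens S by apply: wS; rewrite mem_head.
have [p [pp lp sp]] := IH (g * s).
rewrite big_cons mulgA; have [e|ne] := eqVneq g (g * s).
  by exists p; rewrite -e in pp lp *; split=> //; apply: leqW.
exists (g * s :: p); split=> //=.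
by rewrite pp andbT /cayley_adj ne mulKg.
Qed.

Lemma cayley_path (p : seq G) (g : G) : path cayley_adj g p ->
  exists w : seq G, [/\ {subset w <= gens S}, \prod_(s <- w) s = g^-1 * last g p
                      & size w = size p].
Proof.
elim: p g => [|h p IH] g /=; first by exists [::]; rewrite big_nil mulVg.
move=> /andP[/andP[_ hS] /IH[w [wS ew sw]]].
exists (g^-1 * h :: w); split; last by rewrite /= sw.
- by move=> x; rewrite inE => /predU1P[->|/wS].
- by rewrite big_cons ew -!mulgA mulVKg.
Qed.

Lemma cayley_connected (g h : G) :
  exists2 p, path cayley_adj g p & last g p = h.
Proof.
have [w wS ew] := gens_gen S (g^-1 * h).
have [p [pp lp _]] := cayley_walk g wS.
by exists p; rewrite // lp ew mulVKg.
Qed.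

Lemma cayley_locally_finite (g : G) :
  exists s : seq G, {subset cayley_adj g <= s}.
Proof.
exists [seq g * s | s <- S] => h /andP[_ hS].
by apply/mapP; exists (g^-1 * h); rewrite ?mulVKg.
Qed.

Definition cayley : graph :=
  Graph cayley_sym cayley_irr cayley_connected cayley_locally_finite.

Lemma cayley_dist (g h : cayley) n :
  dist g h n <-> word_length S ((g : G)^-1 * (h : G)) n.
Proof.
split=> [[[p [pp lp sp _]] min]|[[w [wS ew sw]] min]].
  split.
    by have [w [wS ew sw]] := cayley_path pp; exists w; rewrite sw sp ew lp.
  move=> w wS ew; have [q [pq lq sq]] := cayley_walk g wS.
  by apply: leq_trans sq; apply: min; exists q; split=> //; rewrite lq ew mulVKg.
have lower m : walk_in (fun=> True) g h m -> (n <= m)%N.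
  move=> [p [pp lp sp _]]; have [u [uS eu su]] := cayley_path pp.
  by rewrite -sp -su; apply: min => //; rewrite eu lp.
split=> //; have [p [pp lp sp]] := cayley_walk g wS.
have lp' : last g p = h by rewrite lp ew mulVKg.
exists p; split=> //; apply/eqP; rewrite eqn_leq -{1}sw sp /=.
by apply: lower; exists p.
Qed.

End Cayley.

(* [(i, false)] stands for the generator x_i and [(i, true)] for its inverse. *)
Definition word n := seq ('I_n * bool).

Definition eval (G : groupType) n (x : 'I_n -> G) (w : word n) : G :=
  \prod_(l <- w) (if l.2 then (x l.1)^-1 else x l.1).

(* Equality in the presented group < x_0, ..., x_(n-1) | rels >. *)
Inductive pres_eq n (rels : seq (word n)) : word n -> word n -> Prop :=
| pres_refl u : pres_eq rels u u
| pres_symm u v : pres_eq rels u v -> pres_eq rels v u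
| pres_trans u v w : pres_eq rels u v -> pres_eq rels v w -> pres_eq rels u w
| pres_cancel u v i b :
    pres_eq rels (u ++ [:: (i, b); (i, ~~ b)] ++ v) (u ++ v)
| pres_rel u v r : r \in rels -> pres_eq rels (u ++ r ++ v) (u ++ v).

(* Evaluation at [x] induces an isomorphism from the group
   < x_0, ..., x_(n-1) | rels > onto [G]. *)
Definition finitely_presented (G : groupType) : Prop :=
  exists n (x : 'I_n -> G) (rels : seq (word n)),
    (forall g : G, exists w, eval x w = g) /\
    (forall u v, eval x u = eval x v <-> pres_eq rels u v).

(* Main.v *)
Require Import Defs.
From mathcomp Require Import all_boot all_order all_algebra.
From mathcomp Require Import reals boolp classical_sets filter.

(* A compactness argument. If the Cayley graph of (H, T) has the same ball of
   radius m around 1 as X, its edge labels can be carried to that ball of X. If no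
   radius worked, counterexamples for every m would give labellings of larger and
   larger balls of X, and an ultrafilter yields a labelling c of all of X, each
   finite portion of which comes from a counterexample. Whether two label words
   issued from a common vertex lead to the same endpoint then does not depend on
   that vertex. Fix k bounding the relators of a presentation of G and choose a
   counterexample (H, T) that induces c on the ball of radius k around 1. Paths in
   X of length at most k with common ends have label products that agree in H,
   wherever they start; hence the label product of a path from 1 in X depends only
   on its end, and this defines a covering of the Cayley graph of (H, T) by X. *)

Import Num.Theory.

Set Implicit Arguments.
Unset Strict Implicit.
Unset Printing Implicit Defensive.

(** * Balls and intrinsic distances in a graph *)

Section Balls.
Variables (K : realType) (X : graph).
Implicit Types (A : X -> Prop) (x y z : X) (n m : nat).

Lemma ballP n x z : ball x (n%:R%R : K) z <->
  exists p, [/\ path adj x p, last x p = z & size p <= n].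
Proof.
split=> [[m [[p [pp lp sp _]] _]]|[p [pp lp sp]]].
  by rewrite ler_nat => mn; exists p; rewrite sp.
have ex : exists m, `[< walk_in (fun=> True) x z m >].
  by exists (size p); apply/asboolP; exists p.
case: (ex_minnP ex) => m /asboolP wm min.
exists m; last first.
  by rewrite ler_nat (leq_trans _ sp) // min //; apply/asboolP; exists p.
by split=> // k wk; apply: min; apply/asboolP.
Qed.

(** Every vertex of a geodesic issued from the centre is at most as far as its end, so the geodesic
    stays in the ball: the intrinsic metric does not change distances from the centre. *)
Lemma ball_geodesic n m x z : m <= n -> dist x z m ->
  dist_in (ball x (n%:R%R : K)) x z m.
Proof.
move=> mn [[p [pp lp sp _]] min]; split; last first.
  by move=> k [q [pq lq sq _]]; apply: min; exists q.
exists p; split=> // v; rewrite inE => /predU1P[->|].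
  by apply/ballP; exists [::].
move=> vp; case/path.splitP: vp pp lp sp => p1 p2.
rewrite cat_path => /andP[pp1 _] _ sp; apply/ballP; exists (rcons p1 v).
split; rewrite ?last_rcons //; apply: leq_trans mn.
by rewrite -sp size_cat leq_addr.
Qed.

Lemma dist_in0 A x y : A x -> dist_in A x y 0 <-> x = y.
Proof.
move=> Ax; split=> [[[p [_ lp /size0nil p0 _]] _]|<-]; first by rewrite -lp p0.
by split=> //; exists [::]; split=> // z; rewrite inE => /eqP->.
Qed.

Lemma dist_in1 A x y : A x -> A y -> dist_in A x y 1 <-> adj x y.
Proof.
move=> Ax Ay; split=> [[[[|a [|b p]] [//= pp lp _ _]] _]|xy].
  by move: pp lp; rewrite andbT => xa <-.
split.
  exists [:: y]; split=> //=; first by rewrite xy.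
  by move=> z; rewrite !inE => /orP[]/eqP->.
move=> [|//] [p [_ lp /size0nil p0 _]].
by move: xy; rewrite -lp p0 /= adj_irr.
Qed.

End Balls.

Local Open Scope group_scope.

(** * Finite enumeration of the balls of a Cayley graph *)

Section CayleyBalls.
Variables (G : groupType) (S : generating_set G).

(** These are the neighbours of 1. Repetitions are removed, here and in [word_ball], so that
    inclusions and injections can be turned into equalities by counting. *)
Definition nontrivial_gens : seq G := [seq s <- undup S | s != 1].

Fixpoint word_ball n : seq G :=
  if n is m.+1
  then undup (word_ball m ++ [seq g * s | g <- word_ball m, s <- nontrivial_gens])
  else [:: 1].

Lemma mem_nontrivial_gens s : (s \in nontrivial_gens) = (s != 1) && (s \in gens S).
Proof. by rewrite mem_filter mem_undup. Qed.

Lemma cayley_adjE (g h : cayley S) :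
  adj g h = ((g : G)^-1 * (h : G) \in nontrivial_gens).
Proof.
rewrite mem_nontrivial_gens /= /cayley_adj; congr (~~ _ && _).
by apply/eqP/eqP => [->|e]; [rewrite mulVg | rewrite -[RHS](mulVKg g) e mulg1].
Qed.

Lemma word_ball_uniq n : uniq (word_ball n).
Proof. by case: n => [//|n]; rewrite undup_uniq. Qed.

Lemma word_ballS n m g : n <= m -> g \in word_ball n -> g \in word_ball m.
Proof.
elim: m => [|m IH]; first by rewrite leqn0 => /eqP->.
rewrite leq_eqVlt => /predU1P[-> //|/IH{}IH /IH gm].
by rewrite mem_undup mem_cat gm.
Qed.

Lemma word_ball1 n : 1 \in word_ball n.
Proof. by apply: (@word_ballS 0); rewrite ?mem_head. Qed.

Lemma word_ballM n g s : g \in word_ball n -> s \in nontrivial_gens ->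
  g * s \in word_ball n.+1.
Proof.
move=> gn sS; rewrite mem_undup mem_cat; apply/orP; right.
by apply/allpairsP; exists (g, s).
Qed.

Lemma word_ball_gen s : s \in nontrivial_gens -> s \in word_ball 1.
Proof. by rewrite -{2}[s]mul1g; apply: word_ballM; rewrite mem_head. Qed.

Lemma word_ball_prod n g w : g \in word_ball n -> {subset w <= nontrivial_gens} ->
  g * \prod_(s <- w) s \in word_ball (n + size w).
Proof.
elim: w n g => [|s w IH] n g gn wS; first by rewrite big_nil mulg1 addn0.
rewrite big_cons mulgA addnS -addSn; apply: IH.
  by rewrite word_ballM // wS ?mem_head.
by move=> x xw; rewrite wS // inE xw orbT.
Qed.

Lemma word_ballP n (x z : cayley S) :
  (exists p, [/\ path adj x p, last x p = z & size p <= n]) <->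
  (x : G)^-1 * (z : G) \in word_ball n.
Proof.
split=> [[p [pp <- sp]]|].
  apply: word_ballS sp _.
  have [w [wS ew <-]] : exists w : seq G, [/\ {subset w <= nontrivial_gens},
      \prod_(s <- w) s = (x : G)^-1 * (last x p : G) & size w = size p].
    elim: p x pp => [|y p IH] x /=; first by exists [::]; rewrite big_nil mulVg.
    move=> /andP[xy /IH[w [wS ew sw]]].
    exists ((x : G)^-1 * (y : G) :: w); split; last by rewrite /= sw.
    - by move=> u; rewrite inE => /predU1P[->|/wS //]; rewrite -cayley_adjE.
    - by rewrite big_cons ew -!mulgA mulVKg.
  by rewrite -ew -[X in X \in _]mul1g -(add0n (size w)) word_ball_prod ?word_ball1.
elim: n z => [|n IH] z /=.
  rewrite inE => /eqP e; exists [::]; split=> //=.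
  by rewrite -[LHS](mulg1 x) -e mulVKg.
rewrite mem_undup mem_cat => /orP[/IH[p [pp lp sp]]|].
  by exists p; split=> //; apply: leqW.
move=> /allpairsP[[g s] /= [gn sS e]].
have [|p [pp lp sp]] := IH (((x : G) * g) : cayley S); first by rewrite mulKg.
have xz : adj (((x : G) * g) : cayley S) z.
  by rewrite cayley_adjE /= invgM -mulgA e mulKg.
exists (rcons p z); rewrite last_rcons size_rcons rcons_path pp lp.
by split.
Qed.

Lemma word_ball_cover g : exists n, g \in word_ball n.
Proof.
have [p pp lp] := @adj_connected (cayley S) 1 g.
exists (size p); rewrite -[g]mul1g -[X in X * _]invg1.
by apply/word_ballP; exists p.
Qed.

End CayleyBalls.

(** * From isometries of balls to labellings *)

Section LocalModels.
Variables (G : groupType) (S : generating_set G).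
Local Notation D := (nontrivial_gens S).
Local Notation B := (word_ball S).

(* A graph isomorphism [f] from the ball of radius [n] at 1 in [cayley S] onto
   the one in [cayley T] transports the labels of the edges of [cayley T]:
   identifying the two generating sets through [f], [c g s] is the generator
   that labels the image of the edge from [g] to [g * s]. *)
Record local_model (H : groupType) (T : generating_set H) n
    (f : G -> H) (c : G -> G -> G) : Prop := LocalModel {
  model1 : f 1 = 1;
  model_gens : forall s, s \in D -> f s \in nontrivial_gens T;
  model_onto : forall t, t \in nontrivial_gens T -> exists2 s, s \in D & f s = t;
  model_inj : {in B n &, injective f};
  model_label : forall m g s, m < n -> g \in B m -> s \in D ->
    c g s \in D /\ f (g * s) = f g * f (c g s)
}.

Lemma local_modelW (H : groupType) (T : generating_set H) m n f c :
  m <= n -> local_model T n f c -> local_model T m f c.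
Proof.
move=> mn [? ? ? inj lab]; split=> //.
  by move=> g h gm hm; apply: inj; apply: word_ballS mn _.
by move=> k g s km; apply: lab; apply: leq_trans mn.
Qed.

(* The preimage [x0] of the centre of the second ball sees the whole ball of [x]
   within distance [n], so the balls of [x] and [x0], having the same
   cardinality, coincide. *)
Lemma isometric_center (K : realType) (H : groupType) (T : generating_set H) n
    (x : cayley S) (y : cayley T) (F : cayley S -> cayley T) :
  (forall v, ball y (n%:R%R : K) v -> exists2 u, ball x (n%:R%R : K) u & F u = v) ->
  (forall u, ball x (n%:R%R : K) u -> ball y (n%:R%R : K) (F u)) ->
  (forall u v, ball x (n%:R%R : K) u -> ball x (n%:R%R : K) v -> forall m,
     dist_in (ball x (n%:R%R : K)) u v m <->
     dist_in (ball y (n%:R%R : K)) (F u) (F v) m) ->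
  exists2 x0, F x0 = y &
    forall z, ball x (n%:R%R : K) z <-> ball x0 (n%:R%R : K) z.
Proof.
have ballE (u v : cayley S) : ball u (n%:R%R : K) v <-> (u : G)^-1 * (v : G) \in B n.
  by split=> [/ballP/word_ballP|/word_ballP/ballP].
move=> Fonto Fball Fdist.
have /Fonto[x0 xx0 Fx0] : ball y (n%:R%R : K) y by apply/ballP; exists [::].
have sub z : ball x (n%:R%R : K) z -> ball x0 (n%:R%R : K) z.
  move=> xz; have [m dm] := Fball z xz; rewrite ler_nat => mn.
  have : dist_in (ball x (n%:R%R : K)) x0 z m.
    by apply/(Fdist _ _ xx0 xz); rewrite Fx0; apply: ball_geodesic.
  by move=> [[p [pp lp sp _]] _]; apply/ballP; exists p; rewrite sp.
exists x0 => // z; split; first exact: sub.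
pose E (u : G) := [seq u * g | g <- B n].
have mE u z' : (z' \in E u) = (u^-1 * z' \in B n).
  apply/mapP/idP => [[g gB ->]|zB]; first by rewrite mulKg.
  by exists (u^-1 * z'); rewrite ?mulVKg.
have uE u : uniq (E u) by rewrite map_inj_uniq ?word_ball_uniq //; apply: mulgI.
have [||_ eqE] := @uniq_min_size _ (E x) (E x0) (uE x).
- by move=> u; rewrite !mE => /ballE/sub/ballE.
- by rewrite !size_map.
by move=> /ballE; rewrite -mE -eqE mE => /ballE.
Qed.

(** Translating by the preimage of the centre makes the isometry send 1 to 1. It preserves adjacency
    both ways, adjacency being intrinsic distance 1. Hence the edge from [f g] to [f (g * s)] is
    labelled by a generator of [T], and this generator is the image of some [l] in [D]. Positivity
    of [n] puts [D] inside the ball. *)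
Lemma isometric_local_model (K : realType) (H : groupType) (T : generating_set H)
    n (x : cayley S) :
  0 < n -> isometric_balls (n%:R%R : K) x (1 : cayley T) ->
  exists f c, local_model T n f c.
Proof.
move=> n0 [F [Fball Fonto Fdist]].
have [x0 Fx0 ballx0] := isometric_center Fonto Fball Fdist.
have ballE (v : cayley S) : ball x (n%:R%R : K) v <-> (x0 : G)^-1 * (v : G) \in B n.
  by rewrite ballx0; split=> [/ballP/word_ballP|/word_ballP/ballP].
pose f (g : G) : H := F ((x0 : G) * g).
have inB g : g \in B n -> ball x (n%:R%R : K) ((x0 : G) * g).
  by move=> gB; apply/ballE; rewrite mulKg.
have f_inj : {in B n &, injective f}.
  move=> g h /inB gB /inB hB fgh; apply: (mulgI (x0 : G)).
  apply/(@dist_in0 _ (ball x (n%:R%R : K))) => //.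
  by apply/Fdist => //; apply/dist_in0; [apply: Fball | exact: fgh].
have f_adj g h : g \in B n -> h \in B n ->
    (g^-1 * h \in D) = ((f g)^-1 * f h \in nontrivial_gens T).
  move=> /inB gB /inB hB.
  have -> : g^-1 * h = ((x0 : G) * g)^-1 * ((x0 : G) * h).
    by rewrite invgM -mulgA mulKg.
  rewrite -(cayley_adjE ((x0 : G) * g : cayley S) ((x0 : G) * h : cayley S)).
  rewrite -(cayley_adjE (f g : cayley T) (f h : cayley T)).
  apply/idP/idP => [/dist_in1 gh|/dist_in1 gh].
    apply/(@dist_in1 _ (ball (1 : cayley T) (n%:R%R : K))); first exact: Fball.
      exact: Fball.
    by apply/Fdist => //; apply: gh.
  apply/(@dist_in1 _ (ball x (n%:R%R : K))) => //.
  by apply/Fdist => //; apply: gh; apply: Fball.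
have f1 : f 1 = 1 by rewrite /f mulg1.
have B1 s : s \in D -> s \in B n.
  by move=> sD; apply: word_ballS n0 _; apply: word_ball_gen.
have fD s : s \in D -> f s \in nontrivial_gens T.
  move=> sD; have := f_adj 1 s (word_ball1 _ _) (B1 s sD).
  by rewrite f1 !invg1 !mul1g sD => <-.
have ontoD t : t \in nontrivial_gens T -> exists2 s, s \in D & f s = t.
  move=> tT; have /Fonto[u xu Fu] : ball (1 : cayley T) (n%:R%R : K) (t : cayley T).
    apply/ballP/word_ballP; rewrite invg1 mul1g; apply: word_ballS n0 _.
    exact: word_ball_gen.
  have fu : f ((x0 : G)^-1 * (u : G)) = t by rewrite /f mulVKg.
  exists ((x0 : G)^-1 * (u : G)) => //.
  have := f_adj 1 _ (word_ball1 _ _) (proj1 (ballE u) xu).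
  by rewrite f1 !invg1 !mul1g fu tT.
(* Choice needs a total relation: pairs that are not edges inside the ball receive the default label
   1. *)
have /choice[lab labP] (gs : G * G) : exists l, gs.1 \in B n -> gs.2 \in D ->
    gs.1 * gs.2 \in B n -> l \in D /\ f (gs.1 * gs.2) = f gs.1 * f l.
  case: gs => g s /=; have [gB|] := boolP (g \in B n); last by exists 1.
  have [sD|] := boolP (s \in D); last by exists 1.
  have [gsB|] := boolP (g * s \in B n); last by exists 1.
  have := f_adj g (g * s) gB gsB; rewrite mulKg sD => /esym/ontoD[l lD fl].
  by exists l => _ _ _; rewrite fl mulVKg.
exists f, (fun g s => lab (g, s)); split=> // m g s mn gB sD.
apply: (labP (g, s)) => //=; first exact: word_ballS (ltnW mn) gB.
by apply: word_ballS mn _; apply: word_ballM.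
Qed.

(** Distinct edges leaving [g] end at distinct points of the ball of radius [n], which [f]
    separates. *)
Lemma label_inj (H : groupType) (T : generating_set H) n f c m g :
  local_model T n f c -> m < n -> g \in B m ->
  {in D &, injective (c g)}.
Proof.
move=> M mn gB s s' sD s'D cE.
have [_ fs] := model_label M mn gB sD; have [_ fs'] := model_label M mn gB s'D.
have gD u : u \in D -> g * u \in B n.
  by move=> uD; apply: word_ballS mn _; apply: word_ballM.
by apply: (mulgI g); apply: (model_inj M); rewrite ?gD // fs fs' cE.
Qed.

(** * Label words along paths, and limit labellings *)

Fixpoint labels (c : G -> G -> G) (g : G) (w : seq G) : seq G :=
  if w is s :: w' then c g s :: labels c (g * s) w' else [::].

Lemma labels_cat c g w w' :
  labels c g (w ++ w') = labels c g w ++ labels c (g * \prod_(s <- w) s) w'.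
Proof.
elim: w g => [|s w IH] g /=; first by rewrite big_nil mulg1.
by rewrite IH big_cons mulgA.
Qed.

Lemma size_labels c g w : size (labels c g w) = size w.
Proof. by elim: w g => //= s w IH g; rewrite IH. Qed.

Lemma eq_labels c c' m g w : g \in B m -> {subset w <= D} ->
  (forall h s, h \in B (m + size w) -> s \in D -> c h s = c' h s) ->
  labels c g w = labels c' g w.
Proof.
elim: w m g => [//|s w IH] m g gB wD cc' /=.
have sD : s \in D by apply: wD; rewrite mem_head.
rewrite cc' //; last by apply: word_ballS gB; apply: leq_addr.
congr (_ :: _); apply: (IH m.+1); first exact: word_ballM.
  by move=> u uw; apply: wD; rewrite inE uw orbT.
by rewrite addSnnS.
Qed.

Lemma model_prod (H : groupType) (T : generating_set H) n f c m g w :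
  local_model T n f c -> g \in B m -> m + size w <= n -> {subset w <= D} ->
  f (g * \prod_(s <- w) s) = f g * \prod_(l <- labels c g w) f l.
Proof.
move=> M; elim: w m g => [|s w IH] m g gB /= mn wD.
  by rewrite !big_nil !mulg1.
have sD : s \in D by apply: wD; rewrite mem_head.
have mn' : m < n by apply: leq_trans mn; rewrite addnS ltnS leq_addr.
have [_ fgs] := model_label M mn' gB sD.
rewrite !big_cons !mulgA -fgs; apply: (IH m.+1); first exact: word_ballM.
  by rewrite addSnnS.
by move=> u uw; apply: wD; rewrite inE uw orbT.
Qed.

(** The radius is [m.+1] because edges leaving the ball of radius [m] may end one step further
    out. *)
Definition limit_labelling c := forall m, exists (H : groupType)
  (T : generating_set H) f c', local_model T m.+1 f c' /\
    forall h s, h \in B m -> s \in D -> c' h s = c h s.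

Lemma limit_label c : limit_labelling c -> forall g s, s \in D -> c g s \in D.
Proof.
move=> L g s sD; have [m gB] := word_ball_cover S g.
have [H [T [f [c' [M cc']]]]] := L m.
by rewrite -cc' //; have [] := model_label M (ltnSn m) gB sD.
Qed.

Lemma limit_label_inj c : limit_labelling c ->
  forall g, {in D &, injective (c g)}.
Proof.
move=> L g s s' sD s'D; have [m gB] := word_ball_cover S g.
have [H [T [f [c' [M cc']]]]] := L m.
by rewrite -!cc' //; apply: (label_inj M (ltnSn m) gB).
Qed.

(** An injective map from the finite set [D] to itself is onto. *)
Lemma limit_label_onto c : limit_labelling c ->
  forall g l, l \in D -> exists2 s, s \in D & c g s = l.
Proof.
move=> L g l lD.
have DD : {subset [seq c g s | s <- D] <= D}.
  by move=> _ /mapP[s sD ->]; apply: limit_label.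
have uD : uniq D by rewrite filter_uniq ?undup_uniq.
have [||_ eqD] := uniq_min_size _ DD; rewrite ?size_map //.
  by rewrite map_inj_in_uniq //; apply: limit_label_inj.
by move: lD; rewrite -eqD => /mapP[s sD ->]; exists s.
Qed.

(** Path lifting: since every label occurs on an edge leaving each vertex, any label word can be
    followed from any vertex. *)
Lemma labels_lift c : limit_labelling c -> forall g u, {subset u <= D} ->
  exists w, [/\ {subset w <= D}, labels c g w = u & size w = size u].
Proof.
move=> L g u; elim: u g => [|l u IH] g uD; first by exists [::].
have [|s sD cs] := limit_label_onto L g (l := l); first by apply: uD; rewrite mem_head.
have [|w [wD lw sw]] := IH (g * s).
  by move=> v vu; apply: uD; rewrite inE vu orbT.
exists (s :: w); split; rewrite /= ?sw ?lw ?cs //.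
by move=> v; rewrite inE => /predU1P[->|/wD].
Qed.

Lemma limit_labels_sub c : limit_labelling c -> forall g w, {subset w <= D} ->
  {subset labels c g w <= D}.
Proof.
move=> L g w; elim: w g => [//|s w IH] g wD u /=.
rewrite inE => /predU1P[->|].
  by apply: limit_label => //; apply: wD; rewrite mem_head.
by apply: IH => v vw; apply: wD; rewrite inE vw orbT.
Qed.

(* A relation between labels that holds at [g] holds at [1], because every
   finite portion of the limit labelling comes from a Cayley graph; it can then
   be read in any model that is correct near [1]. *)
Lemma limit_labels_transport c k : limit_labelling c ->
  forall (H : groupType) (T : generating_set H) f c', local_model T k.+1 f c' ->
    (forall h s, h \in B k -> s \in D -> c' h s = c h s) ->
  forall g w1 w2, {subset w1 <= D} -> {subset w2 <= D} ->
    size w1 <= k -> size w2 <= k -> \prod_(s <- w1) s = \prod_(s <- w2) s ->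
  \prod_(l <- labels c g w1) f l = \prod_(l <- labels c g w2) f l.
Proof.
move=> L H T f c' M cc' g w1 w2 w1D w2D sw1 sw2 w12.
have [m gB] := word_ball_cover S g.
have [p1 [p1D lp1 sp1]] := labels_lift L 1 (limit_labels_sub L (g := g) w1D).
have [p2 [p2D lp2 sp2]] := labels_lift L 1 (limit_labels_sub L (g := g) w2D).
rewrite size_labels in sp1; rewrite size_labels in sp2.
have B1 p k' : {subset p <= D} -> size p <= k' -> \prod_(s <- p) s \in B k'.
  move=> pD sp; rewrite -[X in X \in _]mul1g; apply: word_ballS sp _.
  by rewrite -(add0n (size p)) word_ball_prod ?mem_head.
have read (H' : groupType) (T' : generating_set H') f' b k' h p i :
    local_model T' k'.+1 f' b -> (forall h s, h \in B k' -> s \in D -> b h s = c h s) ->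
    h \in B i -> {subset p <= D} -> i + size p <= k' ->
    f' (h * \prod_(s <- p) s) = f' h * \prod_(l <- labels c h p) f' l.
  move=> M' bc hB pD ip; rewrite (model_prod M' hB _ pD) ?(leq_trans ip) //.
  rewrite (@eq_labels b c i) // => u s uB sD.
  by apply: bc => //; apply: word_ballS uB.
have read1 (H' : groupType) (T' : generating_set H') f' b k' p :
    local_model T' k'.+1 f' b -> (forall h s, h \in B k' -> s \in D -> b h s = c h s) ->
    {subset p <= D} -> size p <= k' ->
    f' (\prod_(s <- p) s) = \prod_(l <- labels c 1 p) f' l.
  move=> M' bc pD pk; have := read _ _ _ _ _ _ _ 0 M' bc (word_ball1 _ _) pD pk.
  by rewrite (model1 M') !mul1g.
(* A model of radius [(m + k).+1] sees the paths [w1], [w2] from [g] as well as [p1], [p2] from 1.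
   The common end at [g] equates the label products, and injectivity of the model then equates the
   ends at 1. *)
have p12 : \prod_(s <- p1) s = \prod_(s <- p2) s.
  have [H' [T' [f' [b [M' bc]]]]] := L (m + k).
  apply: (model_inj M').
  - by apply: B1; rewrite // sp1 (leq_trans sw1) // (leq_trans (leq_addl m k)).
  - by apply: B1; rewrite // sp2 (leq_trans sw2) // (leq_trans (leq_addl m k)).
  rewrite (read1 _ _ _ _ _ _ M' bc p1D) ?(read1 _ _ _ _ _ _ M' bc p2D).
  - rewrite lp1 lp2; apply: (mulgI (f' g)).
    rewrite -(read _ _ _ _ _ _ _ _ M' bc gB w1D) ?leq_add2l //.
    by rewrite -(read _ _ _ _ _ _ _ _ M' bc gB w2D) ?leq_add2l // w12.
  - by rewrite sp2 (leq_trans sw2) ?leq_addl.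
  - by rewrite sp1 (leq_trans sw1) ?leq_addl.
rewrite -lp1 -lp2 -(read1 _ _ _ _ _ _ M cc' p1D) ?sp1 //.
by rewrite -(read1 _ _ _ _ _ _ M cc' p2D) ?sp2 // p12.
Qed.

End LocalModels.

(** * The covering obtained from a finite presentation *)

Section Presentation.
Variables (G : groupType) (S : generating_set G).
Local Notation D := (nontrivial_gens S).
Variables (n : nat) (x : 'I_n -> G) (rels : seq (word n)).
Hypothesis x_gen : forall g : G, exists w, eval x w = g.
Hypothesis x_rels : forall u v, eval x u = eval x v <-> pres_eq rels u v.

(** The generators of the presentation need not lie in [S], so each letter is spelled as a path in
    the Cayley graph. *)
Lemma letter_word (l : 'I_n * bool) : exists w : seq G,
  {subset w <= D} /\ \prod_(s <- w) s = eval x [:: l].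
Proof.
move: (eval x _) => g; have [w wS <-] := gens_gen S g.
exists [seq s <- w | s != 1]; split.
  by move=> s; rewrite mem_filter mem_nontrivial_gens => /andP[-> /wS].
elim: w {wS} => //= s w IH; rewrite [RHS]big_cons -IH.
by case: eqVneq => [->|_]; rewrite ?mul1g ?big_cons.
Qed.

Lemma presentation_covering : exists k, forall c, limit_labelling S c ->
  forall (H : groupType) (T : generating_set H) f c',
  local_model S T k.+1 f c' ->
  (forall h s, h \in word_ball S k -> s \in D -> c' h s = c h s) ->
  covered_by (cayley T) (cayley S).
Proof.
have [e eP] := choice letter_word; have [word_of word_ofP] := choice x_gen.
pose expand (u : word n) : seq G := flatten [seq e l | l <- u].
have expand_cat u v : expand (u ++ v) = expand u ++ expand v.
  by rewrite /expand map_cat flatten_cat.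
have expandD u : {subset expand u <= D}.
  by move=> s /flatten_mapP[l _ sl]; apply: (proj1 (eP l)).
have evalE u : \prod_(s <- expand u) s = eval x u.
  rewrite /expand; elim: u => [|l u IH] /=; first by rewrite /eval !big_nil.
  rewrite big_cat /= IH; have [_ ->] := eP l.
  by rewrite /eval !big_cons big_nil mulg1.
(* The three maxima bound the relators, the cancelling pairs, and the spellings of elements of [D].
   The successor in [k] makes room for a one-letter word even if all three vanish. *)
pose k1 := \max_(r <- rels) size (expand r).
pose k2 := \max_(l : 'I_n * bool) size (expand [:: l; (l.1, ~~ l.2)]).
pose k3 := \max_(s <- D) size (expand (word_of s)).
pose k := (maxn k1 (maxn k2 k3)).+1.
have lek1 r : r \in rels -> size (expand r) <= k.
  move=> rR; apply: leqW; rewrite leq_max; apply/orP; left.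
  exact: (leq_bigmax_seq (F := fun r => size (expand r))).
have lek2 l : size (expand [:: l; (l.1, ~~ l.2)]) <= k.
  apply: leqW; rewrite !leq_max; apply/orP; right; apply/orP; left.
  exact: (leq_bigmax (F := fun l => size (expand [:: l; (l.1, ~~ l.2)])) l).
have lek3 s : s \in D -> size (expand (word_of s)) <= k.
  move=> sD; apply: leqW; rewrite !leq_max; apply/orP; right; apply/orP; right.
  exact: (leq_bigmax_seq (F := fun s => size (expand (word_of s)))).
exists k => c L H T f c' M cc'.
have transport := limit_labels_transport L M cc'.
(* This is the holonomy in [H] of the path from [g] spelled by [u]. *)
pose hol g u := \prod_(l <- labels c g (expand u)) f l.
have hol_cat g u v : hol g (u ++ v) = hol g u * hol (g * eval x u) v.
  by rewrite /hol expand_cat labels_cat big_cat evalE.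
have evalD u v : eval x (u ++ v) = eval x u * eval x v by rewrite /eval big_cat.
(* A short closed path is compared with the empty path. *)
have hol_relator g r : size (expand r) <= k -> eval x r = 1 -> hol g r = 1.
  move=> rk r1; rewrite /hol (transport g (expand r) [::]) ?big_nil ?evalE //.
have drop_relator g u v r : size (expand r) <= k ->
    eval x (u ++ r ++ v) = eval x (u ++ v) -> hol g (u ++ r ++ v) = hol g (u ++ v).
  rewrite !evalD => rk /mulgI rv; have r1 : eval x r = 1.
    by apply: (mulIg (eval x v)); rewrite rv mul1g.
  by rewrite !hol_cat (hol_relator _ r) // mul1g r1 mulg1.
have hol_pres u v : pres_eq rels u v -> forall g, hol g u = hol g v.
  elim=> [//|{}u {}v _ IH g|{}u {}v w _ IH1 _ IH2 g|{}u {}v i b g|{}u {}v r rR g].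
  - by rewrite IH.
  - by rewrite IH1.
  - apply: drop_relator (lek2 (i, b)) _.
    by apply/x_rels; apply: pres_cancel.
  - by apply: drop_relator (lek1 r rR) _; apply/x_rels; apply: pres_rel.
(* By [hol_pres] the choice of the word representing [g] does not affect the value. *)
pose phi (g : G) : H := hol 1 (word_of g).
have phiM g s : s \in D -> phi (g * s) = phi g * f (c g s).
  move=> sD; rewrite /phi.
  have -> : hol 1 (word_of (g * s)) = hol 1 (word_of g ++ word_of s).
    by apply: hol_pres; apply/x_rels; rewrite evalD !word_ofP.
  rewrite hol_cat mul1g word_ofP; congr (_ * _).
  (* The spelling of [s] and the single edge [s] have the same ends, hence the same holonomy. *)
  rewrite /hol (transport g (expand (word_of s)) [:: s]) /= ?big_seq1 //.
  - by move=> u; rewrite inE => /eqP->.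
  - exact: lek3.
  - by rewrite evalE word_ofP.
have phi_edge (g h : cayley S) : adj g h -> exists2 s, s \in D &
    (h = g * s :> G) /\ phi h = phi g * f (c g s).
  rewrite cayley_adjE => gh; exists ((g : G)^-1 * (h : G)) => //.
  by rewrite -phiM // !mulVKg.
have phi_adj (g h : cayley S) : adj g h -> adj (phi g : cayley T) (phi h : cayley T).
  move=> /phi_edge[s sD [_ phih]].
  by rewrite (cayley_adjE (phi g : cayley T)) phih mulKg (model_gens M) ?limit_label.
have phi_lift (g : cayley S) (y : cayley T) : adj (phi g : cayley T) y ->
    exists2 h, adj g h & phi h = y.
  rewrite (cayley_adjE (phi g : cayley T)) => /(model_onto M)[l lD fl].
  have [s sD cs] := limit_label_onto L g lD.
  exists ((g : G) * s : cayley S).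
    by rewrite (cayley_adjE g ((g : G) * s : cayley S)) mulKg.
  by rewrite phiM // cs fl mulVKg.
exists phi; split=> //.
(* Surjectivity: a path from [phi 1] to [y] is lifted edge by edge. *)
- move=> y; have [p pp <-] := @adj_connected (cayley T) (phi 1) y.
  elim: p {1 2}(1 : cayley S) pp => [|z p IH] g /=; first by exists g.
  by move=> /andP[/phi_lift[h _ <-] /IH].
(* Local injectivity: both labels lie in the ball of radius 1, where [f] is injective, and the
   labelling at [g] is injective too. *)
- move=> g h h' /phi_edge[s sD [-> ->]] /phi_edge[s' s'D [-> ->]] /mulgI eqf.
  congr (_ * _); apply: (limit_label_inj L) => //; apply: (model_inj M) eqf.
    exact/(word_ballS (ltn0Sn k))/word_ball_gen/limit_label.
  exact/(word_ballS (ltn0Sn k))/word_ball_gen/limit_label.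
Qed.

End Presentation.

(** * Compactness by ultrafilters *)

Lemma ultrafilter_finite_choice (I : Type) (L : eqType) (U : set_system I)
    (v : I -> L) (s : seq L) : UltraFilter U ->
  (\forall i \near U, v i \in s) -> exists l, \forall i \near U, v i = l.
Proof.
move=> UU; elim: s => [|l s IH] vs; first by have [] := filter_ex vs.
have [vl|vl] := in_ultra_setVsetC [set i | v i = l] UU; first by exists l.
apply: IH; apply: filterS2 vs vl => i.
by rewrite inE => /predU1P[].
Qed.

(** The limit [c] is taken value by value along an ultrafilter containing all tails of the integers.
    [Q] marks the arguments at which [P n], for some [n], confines the value to the finite list [V];
    finitely many of them are stabilised by a single index. *)
Lemma pointwise_compactness (A L : eqType) (Q : pred A) (V : seq L)
    (P : nat -> (A -> L) -> Prop) :
  (forall n, exists c, P n c) ->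
  (forall m n c, m <= n -> P n c -> P m c) ->
  (forall a, Q a -> exists n, forall c, P n c -> c a \in V) ->
  exists c, forall n (s : seq A),
    exists2 c', P n c' & {in s, forall a, Q a -> c' a = c a}.
Proof.
move=> /choice[cl clP] Pmono PV.
have [U [UU Uoo]] := ultraFilterLemma eventually_filter.
have big n : \forall i \near U, n <= i by apply: Uoo; exists n.
have /choice[c cP] a : exists l, Q a -> \forall i \near U, cl i a = l.
  have [Qa|] := boolP (Q a); last by exists (cl 0 a).
  have [n nV] := PV a Qa.
  have [|l] := ultrafilter_finite_choice (v := cl ^~ a) (s := V) UU.
    by apply: filterS (big n) => i ni; apply/nV/(Pmono _ _ _ ni).
  by exists l.
exists c => n s.
have /filter_ex[i [ni iP]] : \forall i \near U,
    n <= i /\ {in s, forall a, Q a -> cl i a = c a}.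
  apply: filterI (big n) _; elim: s => [|a s IH].
    by apply: filterS (big 0) => i _ a.
  have aP : \forall i \near U, Q a -> cl i a = c a.
    have [Qa|/negP nQa] := boolP (Q a); last by apply: filterS (big 0).
    by apply: filterS (cP a Qa).
  apply: filterS2 IH aP => i si ai b.
  by rewrite inE => /predU1P[->|/si].
by exists (cl i); first exact: Pmono ni _.
Qed.

(** * Existence of the radius, by contradiction *)

Theorem corollary1p6 (K : realType) (G : groupType) (S : generating_set G)
    (hG : finitely_presented G) :
  exists r : K, (0 < r)%R /\
    forall (H : groupType) (T : generating_set H),
      locally r (cayley S) (cayley T) -> covered_by (cayley T) (cayley S).
Proof.
have [n [x [rels [x_gen x_rels]]]] := hG.
have [k kP] := presentation_covering S x_gen x_rels.
apply: contrapT => noR.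
pose bad m (c : G * G -> G) := exists (H : groupType) (T : generating_set H) f,
  local_model S T m f (fun g s => c (g, s)) /\ ~ covered_by (cayley T) (cayley S).
have badP m : exists c, bad m c.
  (* Radius [m.+1] is positive, as [isometric_local_model] requires; the resulting model is then
     restricted to radius [m]. *)
  apply: contrapT => nobad; apply: noR; exists m.+1%:R%R; split.
    by rewrite ltr0n.
  move=> H T /(_ 1)[y /isometric_local_model[//|f [c M]]].
  apply: contrapT => ncov; apply: nobad; exists (fun gs => c gs.1 gs.2), H, T, f.
  by split=> //; apply: local_modelW M.
have bad_mono m m' c : m <= m' -> bad m' c -> bad m c.
  move=> mm' [H [T [f [M ncov]]]]; exists H, T, f.
  by split=> //; apply: local_modelW M.
have [|c cP] := pointwise_compactness (Q := fun gs => gs.2 \in nontrivial_gens S)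
    (V := nontrivial_gens S) badP bad_mono.
  move=> [g s] /= sD; have [m gB] := word_ball_cover S g.
  exists m.+1 => c [H [T [f [M _]]]].
  by have [] := model_label M (ltnSn m) gB sD.
have agree m : exists (H : groupType) (T : generating_set H) f c',
    [/\ local_model S T m.+1 f c', ~ covered_by (cayley T) (cayley S) &
      forall h s, h \in word_ball S m -> s \in nontrivial_gens S ->
        c' h s = c (h, s)].
  (* Agreement is requested on the finitely many edges issued from the ball of radius [m]. *)
  have [c' [H [T [f [M ncov]]]] cc'] := cP m.+1
    [seq (h, s) | h <- word_ball S m, s <- nontrivial_gens S].
  exists H, T, f, (fun h s => c' (h, s)); split=> // h s hB sD.
  by apply: cc' => //; apply: allpairs_f.
have L : limit_labelling S (fun g s => c (g, s)).
  by move=> m; have [H [T [f [c' [M _ cc']]]]] := agree m; exists H, T, f, c'.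
have [H [T [f [c' [M ncov cc']]]]] := agree k.
exact: ncov (kP _ L _ _ _ _ M cc').
Qed.
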